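(* For every integer $n\ge 7$, Bob has a winning strategy in the prefix normal game starting from $n$ empty positions.
   Context: A binary word $w$ is prefix normal if for every $1\le i\le |w|$, no (contiguous) substring of $w$ of length $i$ contains more $1$s than the prefix of $w$ of length $i$. Prefix normal game starting from empty positions: two players, Alice and Bob, start with $n$ empty positions, numbered $1,\dots,n$. Alice moves first. In alternating moves, the player to move picks any empty position and sets it to $0$ or $1$, as they choose. The game ends after $n$ moves, when all positions are filled. Alice wins if and only if the resulting binary word of length $n$ is prefix normal; otherwise Bob wins. *)

(* Defs.v *)
From mathcomp Require Import all_boot.

Set Implicit Arguments.
Unset Strict Implicit.
Unset Printing Implicit Defensive.

(* The bits 0 and 1 are [false] and [true]. *)
Definition prefix_normal (w : seq bool) : Prop :=
  forall i : nat, 1 <= i <= size w ->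
  forall u : seq bool, infix u w -> size u = i ->
  count_mem true u <= count_mem true (take i w).

(* [None] marks an empty position; position k of the game is the ordinal of
   value k - 1. *)
Definition board (n : nat) := {ffun 'I_n -> option bool}.

Definition empty_board (n : nat) : board n := [ffun=> None].

(* The move (i, b) sets position i to the bit b. *)
Definition move (n : nat) : Type := ('I_n * bool)%type.

Definition legal (n : nat) (B : board n) (m : move n) : bool :=
  B m.1 == None.

Definition play (n : nat) (B : board n) (m : move n) : board n :=
  [ffun j => if j == m.1 then Some m.2 else B j].

(* Histories list the moves made so far in chronological order; Alice moves
   after histories of even length and Bob after those of odd length. *)
Definition board_after (n : nat) (h : seq (move n)) : board n :=
  foldl (@play n) (empty_board n) h.

(* [pmap] would drop empty positions; on a full board this is the whole word
   of length n. *)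
Definition word_of (n : nat) (B : board n) : seq bool := pmap B (enum 'I_n).

Definition strategy (n : nat) : Type := seq (move n) -> move n.

Inductive reachable (n : nat) (sigma : strategy n) : seq (move n) -> Prop :=
| reachable_start : reachable sigma [::]
| reachable_Alice (h : seq (move n)) (m : move n) :
    reachable sigma h -> ~~ odd (size h) -> legal (board_after h) m ->
    reachable sigma (rcons h m)
| reachable_Bob (h : seq (move n)) :
    reachable sigma h -> odd (size h) -> legal (board_after h) (sigma h) ->
    reachable sigma (rcons h (sigma h)).

(* The first clause is what prevents a strategy from "winning" by prescribing
   an illegal move, after which no completed play would be reachable. *)
Definition Bob_winning_strategy (n : nat) (sigma : strategy n) : Prop :=
  (forall h, reachable sigma h -> odd (size h) -> size h < n ->
     legal (board_after h) (sigma h)) /\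
  (forall h, reachable sigma h -> size h = n ->
     ~ prefix_normal (word_of (board_after h))).

(* Main.v *)
(* Bob attacks the prefix. Unless Alice opens with a 1 in position 1, Bob puts a
   0 there (or finds one there), and any later 1 beats the prefix of length 1.
   Otherwise Bob sets position 2 to 0, so that the prefix of length 2 has a
   single 1 and any factor 11 wins; he then plays a 1 whose two neighbours are
   empty, a double threat. The only other case used is 1001_1, where the factor
   1_1 beats the prefix 100. *)

Require Import Defs.
From mathcomp Require Import all_boot.

Set Implicit Arguments.
Unset Strict Implicit.
Unset Printing Implicit Defensive.

Section PrefixNormalGame.

Variable n : nat.
Implicit Types (B : board n) (m : move n) (h : seq (move n)) (i j : 'I_n).

(** * Boards that no completion can make prefix normal *)

Definition window (s L : nat) : seq 'I_n := take L (drop s (enum 'I_n)).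

Lemma mem_window s L i : s + L <= n -> (i \in window s L) = (s <= i < s + L).
Proof.
move=> le_n; rewrite -(mem_map val_inj) map_take map_drop val_enum_ord.
by rewrite drop_iota take_iota (minn_idPl _) ?leq_subRL ?mem_iota // (leq_trans _ le_n) ?leq_addr.
Qed.

Lemma window_uniq s L : uniq (window s L).
Proof. by rewrite take_uniq ?drop_uniq ?enum_uniq. Qed.

(* The 1s already in some factor outnumber those that the prefix of the same
   length can still get, so no completion is prefix normal. *)
Definition doomed B : bool :=
  [exists s : 'I_n, [exists L : 'I_n, (s + L < n) &&
    (count (fun i => B i != Some false) (window 0 L.+1)
       < count (fun i => B i == Some true) (window s L.+1))]].

(** A legal move only fills an empty position, so no candidate 1 appears in the prefix and no placed
    1 leaves the factor. *)
Lemma doomed_play B m : legal B m -> doomed B -> doomed (play B m).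
Proof.
move=> /eqP Bm /existsP[s /existsP[L /andP[le_n lt_c]]].
apply/existsP; exists s; apply/existsP; exists L; rewrite le_n /=.
apply: leq_ltn_trans (leq_trans lt_c _); apply: sub_count => i /=;
  by rewrite ffunE; case: (i =P m.1) => [->|//]; rewrite Bm.
Qed.

Lemma doomed_not_prefix_normal B :
  (forall i, B i != None) -> doomed B -> ~ prefix_normal (word_of B).
Proof.
move=> fullB /existsP[s /existsP[L /andP[le_n lt_c]]] pn.
have wE : word_of B = [seq B i == Some true | i <- enum 'I_n].
  rewrite /word_of; elim: (enum _) => //= i e ->.
  by case: (B i) (fullB i) => [[]|].
have szw : size (word_of B) = n by rewrite wE size_map size_enum_ord.
(* The ordinal [L] stands for the length [L.+1], so [s + L < n] says that the factor fits in the
   word. *)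
have := pn L.+1 _ (take L.+1 (drop s (word_of B))).
rewrite szw ltn_ord => /(_ isT) le_c.
have {}le_c : count_mem true (take L.+1 (drop s (word_of B)))
    <= count_mem true (take L.+1 (word_of B)).
  apply: le_c; first exact: (infix_trans (infix_take _ _) (infix_drop _ _)).
  by rewrite size_takel // size_drop szw ltn_subRL.
move: le_c; rewrite leqNgt => /negP[].
move: lt_c; rewrite wE /window drop0; move: (enum 'I_n) => e lt_c.
rewrite -map_drop -!map_take !count_map.
apply: leq_ltn_trans (leq_trans lt_c _); apply: eq_leq; apply: eq_count => i /=.
  by case: (B i) (fullB i) => [[]|].
by case: (B i) => [[]|].
Qed.

Lemma doomed_head B i j :
  val i = 0 -> B i = Some false -> B j = Some true -> doomed B.
Proof.
(* As a length index, [i] of value 0 means length 1: the factor is the single position [j]. *)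
move=> i0 Bi Bj; apply/existsP; exists j; apply/existsP; exists i.
rewrite i0 addn0 ltn_ord /=.
have n0 : 0 < n by apply: leq_ltn_trans (ltn_ord i).
have -> : count (fun k => B k != Some false) (window 0 1) = 0.
  apply/eqP; rewrite -leqn0 leqNgt -has_count; apply/hasPn => k.
  rewrite mem_window // => /andP[_ k0].
  rewrite (_ : k = i) ?Bi //; apply: val_inj; rewrite i0.
  by apply/eqP; rewrite -leqn0; exact: k0.
rewrite -has_count; apply/hasP; exists j; last by rewrite Bj.
by rewrite mem_window ?addn1 // leqnn ltnSn.
Qed.

(** The prefix of length [d.+1] can have a 1 only at index 0, while the factor from [i] to [j], of
    the same length, already has two. *)
Lemma doomed_pair B i j d :
  0 < d -> j = i + d :> nat -> B i = Some true -> B j = Some true ->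
  (forall k : 'I_n, 0 < k <= d -> B k = Some false) -> doomed B.
Proof.
move=> d0 jE Bi Bj Bd.
have dn : d < n by apply: leq_ltn_trans (ltn_ord j); rewrite jE leq_addl.
apply/existsP; exists i; apply/existsP; exists (Ordinal dn); rewrite /= -jE ltn_ord /=.
have n0 : 0 < n by apply: leq_ltn_trans dn.
apply: (@leq_ltn_trans 1).
  rewrite -size_filter.
  apply: (@uniq_leq_size _ _ [:: Ordinal n0]); first by rewrite filter_uniq ?window_uniq.
  move=> k; rewrite mem_filter mem_window // inE -val_eqE /= => /andP[Bk lek].
  by apply: contraR Bk; rewrite -lt0n => k0; rewrite Bd ?eqxx // k0.
rewrite -size_filter.
apply: (@uniq_leq_size _ [:: i; j]).
  by rewrite /= andbT inE -val_eqE /= jE -{1}[val i]addn0 eqn_add2l eq_sym -lt0n.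
move=> k; rewrite mem_filter !inE mem_window addnS -?jE //.
by case/orP=> /eqP->; rewrite ?Bi ?Bj eqxx ltnS jE leq_addr leqnn.
Qed.

(** * From forced doom to a winning strategy *)

Definition empties B : nat := #|[pred i | B i == None]|.

Lemma empties_play B m : legal B m -> empties B = (empties (play B m)).+1.
Proof.
move=> lm; rewrite /empties (cardD1 m.1) inE [B _ == _]lm add1n; congr _.+1.
by apply: eq_card => i; rewrite !inE ffunE; case: (i =P m.1).
Qed.

Lemma empties_reachable sigma h :
  reachable sigma h -> empties (board_after h) + size h = n.
Proof.
elim=> [|{}h m _ IH _ lm|{}h _ IH _ lm]; last 2 first.
- by rewrite size_rcons addnS -addSn /board_after foldl_rcons -(empties_play lm).
- by rewrite size_rcons addnS -addSn /board_after foldl_rcons -(empties_play lm).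
by rewrite addn0 -[RHS]card_ord; apply: eq_card => i; rewrite !inE ffunE.
Qed.

(* Alice is to move, and within k rounds Bob can force a doomed board. *)
Fixpoint dooms (k : nat) B : bool :=
  doomed B || if k is k'.+1 then
    [forall m, legal B m ==>
      [exists m', legal (play B m) m' && dooms k' (play (play B m) m')]]
  else false.

Lemma doomed_dooms k B : doomed B -> dooms k B.
Proof. by case: k => /= [|k] ->. Qed.

Lemma dooms_step k B :
  (forall m, legal B m -> exists m',
     legal (play B m) m' /\ dooms k (play (play B m) m')) -> dooms k.+1 B.
Proof.
move=> win /=; apply/orP; right; apply/forallP => m; apply/implyP => lm.
by have [m' [lm' wm']] := win m lm; apply/existsP; exists m'; rewrite lm'.
Qed.

(** Bob always picks a move that keeps doom forced within the rounds left. Since [k.*2 <= n], these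
    rounds run out by the end of the game, and [dooms 0] is [doomed]. *)
Lemma dooms_Bob_wins k :
  0 < n -> k.*2 <= n -> dooms k (empty_board n) ->
  exists sigma : strategy n, Bob_winning_strategy sigma.
Proof.
move=> n0 le_kn win0.
(* Bob moves after an odd history, and his move completes round [uphalf (size h)]. *)
pose good h m := legal (board_after h) m &&
  dooms (k - uphalf (size h)) (play (board_after h) m).
(* The fallback to any legal move makes [sigma] legal while a position is empty; the last default
   occurs only on a full board. *)
pose sigma : strategy n := fun h =>
  odflt (odflt (Ordinal n0, true) [pick m | legal (board_after h) m]) [pick m | good h m].
have goodP h : (exists m, good h m) -> good h (sigma h).
  by case=> m gm; rewrite /sigma; case: (pickP (good h)) => [//|/(_ m)]; rewrite gm.
(* The alternative [doomed] covers a last move by Alice, for odd [n], after which Bob has no legal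
   move. *)
have inv h : reachable sigma h ->
  if odd (size h) then doomed (board_after h) \/ good h (sigma h)
  else dooms (k - (size h)./2) (board_after h).
  elim=> [|{}h m _ IH ev lm|{}h _ IH od lm].
  - by rewrite /= subn0.
  - rewrite size_rcons /= ev; rewrite (negbTE ev) in IH.
    have bE : board_after (rcons h m) = play (board_after h) m.
      by rewrite /board_after foldl_rcons.
    have kE : k - uphalf (size (rcons h m)) = (k - (size h)./2).-1.
      by rewrite size_rcons /= subnS.
    have dm : doomed (board_after h) -> doomed (board_after (rcons h m)).
      by rewrite bE; apply: doomed_play.
    case: (k - _) IH kE => [|k'] /= /orP[d|win] kE //; try by left; apply: dm.
    have /existsP[m' gm'] := implyP (forallP win m) lm.
    by right; apply: goodP; exists m'; rewrite /good bE kE.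
  - rewrite size_rcons /= od /=; rewrite od in IH.
    rewrite /board_after foldl_rcons -/(board_after h).
    case: IH => [d|/andP[]//]; exact/doomed_dooms/doomed_play.
exists sigma; split=> [h rh od lt_n | h rh szh].
  have := empties_reachable rh => eh.
  have /card_gt0P[i li] : 0 < empties (board_after h).
    by rewrite -(ltn_add2r (size h)) add0n eh.
  rewrite /sigma; case: (pickP (good h)) => [m /andP[]//|_] /=.
  case: (pickP (legal _)) => [//|/(_ (i, true))]; rewrite /legal /= => /negbT/negP[]; exact: li.
have full : forall i, board_after h i != None.
  have /card0_eq e : empties (board_after h) = 0.
    by apply: (@addIn (size h)); rewrite (empties_reachable rh) szh.
  by move=> i; have := e i; rewrite inE => ->.
apply: doomed_not_prefix_normal => //.
have := inv h rh; case: ifP => _.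
  by case=> // /andP[]; rewrite /legal (negbTE (full _)).
have -> : k - (size h)./2 = 0.
  by apply/eqP; rewrite subn_eq0 szh -(doubleK k) half_leq.
by rewrite /= orbF.
Qed.

End PrefixNormalGame.

(** * Bob's threats near the prefix *)

Arguments dooms : simpl never.

(** Alice fills one empty position; a second one is left for Bob's 1. *)
Lemma dooms_head_false n (B : board n) (i : 'I_n) k :
  val i = 0 -> B i = Some false -> 1 < empties B -> dooms k.+1 B.
Proof.
move=> i0 Bi gt1; apply: dooms_step => m lm.
have /card_gt0P[j lj] : 0 < empties (play B m) by rewrite -ltnS -(empties_play lm).
exists (j, true); split; first exact: lj.
apply/doomed_dooms/(@doomed_head _ _ i j i0); last by rewrite ffunE eqxx.
have Bmi : play B m i = Some false.
  by rewrite ffunE; case: (i =P m.1) => // im; move: lm; rewrite /legal -im Bi.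
by rewrite ffunE; case: (i =P j) => // ij; move: lj; rewrite inE -ij Bmi.
Qed.

Lemma play_comm n (B : board n) m m' :
  m.1 != m'.1 -> play (play B m) m' = play (play B m') m.
Proof.
move=> neq; apply/ffunP => i; rewrite !ffunE.
by case: (i =P m'.1) => // ->; rewrite eq_sym (negbTE neq).
Qed.

Lemma legal_play n (B : board n) m m' :
  m.1 != m'.1 -> legal B m' -> legal (play B m) m'.
Proof. by move=> neq; rewrite /legal ffunE [_.1 == _]eq_sym (negbTE neq). Qed.

(** Alice can occupy only one of the two positions. Bob plays at the other, and her move, which
    commutes with his, cannot undo the doom. *)
Lemma dooms_fork n (B : board n) m1 m2 :
  m1.1 != m2.1 -> legal B m1 -> legal B m2 ->
  doomed (play B m1) -> doomed (play B m2) -> dooms 1 B.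
Proof.
move=> neq l1 l2 d1 d2; apply: dooms_step => m lm.
have reply m' : m.1 != m'.1 -> legal B m' -> doomed (play B m') ->
  exists m', legal (play B m) m' /\ dooms 0 (play (play B m) m').
  move=> neqm l d; exists m'; split; first exact: legal_play.
  apply: doomed_dooms; rewrite play_comm //; apply: doomed_play => //.
  by apply: legal_play; rewrite // eq_sym.
have [e|ne] := eqVneq m.1 m1.1; last exact: reply ne l1 d1.
by apply: (reply m2); rewrite // e.
Qed.

Lemma doomed_11 n (B : board n) (q i j : 'I_n) :
  val q = 1 -> j = i.+1 :> nat ->
  B q = Some false -> B i = Some true -> B j = Some true -> doomed B.
Proof.
move=> q1 jE Bq Bi Bj; apply: (@doomed_pair _ _ i j 1); rewrite ?addn1 //.
move=> x x1; rewrite (_ : x = q) //; apply: val_inj.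
by rewrite q1; apply/eqP; rewrite eqn_leq andbC.
Qed.

Lemma dooms_11_fork n (B : board n) (q a i b : 'I_n) :
  val q = 1 -> i = a.+1 :> nat -> b = i.+1 :> nat ->
  B q = Some false -> B a = None -> B i = Some true -> B b = None -> dooms 1 B.
Proof.
move=> q1 iE bE Bq Ba Bi Bb.
have nqa : q != a by apply: contra_eq_neq Bq => ->; rewrite Ba.
have nqb : q != b by apply: contra_eq_neq Bq => ->; rewrite Bb.
have nia : i != a by apply: contra_eq_neq Bi => ->; rewrite Ba.
have nib : i != b by apply: contra_eq_neq Bi => ->; rewrite Bb.
apply: (@dooms_fork _ _ (a, true) (b, true)); rewrite /legal /= ?Ba ?Bb //.
- by rewrite -val_eqE /= bE iE ltn_eqF.
- by apply: (doomed_11 q1 iE); rewrite ffunE /= ?eqxx // (negbTE nqa, negbTE nia).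
- by apply: (doomed_11 q1 bE); rewrite ffunE /= ?eqxx // (negbTE nqb, negbTE nib).
Qed.

(** Bob threatens 11 at indices 2 and 3, so Alice must play at 2. A 1 there makes 11 itself; a 0
    leaves at most one 1 in the prefix of length 3, and a 1 at 5 beats it from 3 to 5, whatever
    index 4 holds. *)
Lemma dooms_1001 n (B : board n) (q a i b : 'I_n) :
  val q = 1 -> val a = 2 -> val i = 3 -> val b = 5 ->
  B q = Some false -> B a = None -> B i = Some true -> B b = None -> dooms 1 B.
Proof.
move=> q1 a2 i3 b5 Bq Ba Bi Bb.
have E (x y : 'I_n) : (x == y) = (val x == val y) by [].
have ia : i = a.+1 :> nat by rewrite [LHS]i3 [val a in RHS]a2.
apply: dooms_step => m /eqP lm.
have nmq : q != m.1 by apply: contra_eq_neq Bq => ->; rewrite lm.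
have nmi : i != m.1 by apply: contra_eq_neq Bi => ->; rewrite lm.
have [ma|nma] := eqVneq m.1 a.
  exists (b, true); split; first by rewrite /legal ffunE /= ma E a2 b5 /= Bb.
  apply: doomed_dooms; case: m ma {lm nmq nmi} => [_ []] /= ->.
    by apply: (doomed_11 q1 ia); rewrite !ffunE /= !E ?q1 ?a2 ?i3 ?b5.
  apply: (@doomed_pair _ _ i b 2) => //; first by rewrite [LHS]b5 [val i in RHS]i3.
  - by rewrite !ffunE /= !E i3 a2 b5.
  - by rewrite !ffunE /= eqxx.
  - move=> x /andP[x0 x2]; have x5 : val x < 5 by apply: leq_ltn_trans x2 _.
    rewrite !ffunE /= !E b5 a2 ltn_eqF //.
    case: eqP => // /eqP nx2; rewrite (_ : x = q) //; apply: val_inj.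
    by rewrite q1; case: x x0 x2 nx2 {x5} => [[|[|[|]]] ?].
exists (a, true); split; first by apply: legal_play; rewrite /legal ?Ba.
apply/doomed_dooms/(doomed_11 q1 ia); rewrite !ffunE /= ?eqxx //.
- by rewrite (negbTE nmq) E q1 a2.
- by rewrite (negbTE nmi) E i3 a2.
Qed.

Theorem lemma9 (n : nat) (hn : 7 <= n) :
  exists sigma : strategy n, Bob_winning_strategy sigma.
Proof.
(* Three rounds suffice: a reply on the first two positions, a 1 that creates threats, and a 1 that
   carries one out. *)
apply: (@dooms_Bob_wins _ 3); [exact: leq_trans hn | exact: leq_trans hn |].
pose p x (lt : x < 7) : 'I_n := Ordinal (leq_trans lt hn).
pose p0 := p 0 isT; pose p1 := p 1 isT; pose p2 := p 2 isT; pose p3 := p 3 isT.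
pose p4 := p 4 isT; pose p5 := p 5 isT; pose p6 := p 6 isT.
have E (x y : 'I_n) : (x == y) = (val x == val y) by [].
apply: dooms_step => m _.
have emptyE x : empty_board n x = None by rewrite ffunE.
have [m0|nm0] := eqVneq m.1 p0; last first.
  have l0 : legal (play (empty_board n) m) (p0, false).
    by apply: legal_play; rewrite /legal //= emptyE.
  exists (p0, false); split=> //; apply: (@dooms_head_false _ _ p0) => //.
    by rewrite ffunE eqxx.
  (* Only two of at least 7 positions are filled. *)
  rewrite -ltnS -(empties_play l0) -ltnS -empties_play ?/legal ?emptyE //.
  apply: leq_trans (leq_trans (isT : 3 < 7) hn) _.
  by rewrite -{1}[n]card_ord; apply: eq_leq; apply: eq_card => i; rewrite !inE emptyE.
have l1 b : legal (play (empty_board n) m) (p1, b).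
  by apply: legal_play; rewrite /legal /= ?emptyE // m0.
case: m m0 l1 => [_ []] /= -> l1; last first.
  exists (p1, true); split; first exact: l1.
  apply/doomed_dooms/(@doomed_head _ _ p0 p1) => //.
    by rewrite !ffunE.
  by rewrite ffunE eqxx.
exists (p1, false); split; first exact: l1.
set B := play _ _.
have BE x : B x = if x == p1 then Some false else if x == p0 then Some true else None.
  by rewrite !ffunE.
apply: dooms_step => -[j c] /eqP /= Bj.
have jgt1 : 1 < j.
  by move: Bj; rewrite BE !E; case: j => [[|[|?]] ?].
have playE i x : play (play B (j, c)) (i, true) x =
    if x == i then Some true else if x == j then Some c else B x.
  by rewrite !ffunE.
have legalE (i : 'I_n) : 1 < i -> i != j -> legal (play B (j, c)) (i, true).
  move=> i1 ij; rewrite /legal ffunE (negbTE ij) BE !E.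
  by case: i i1 {ij} => [[|[|?]] ?].
have ne1 : (1 == val j) = false by rewrite ltn_eqF.
(* Alice's second position [j] decides where Bob's 1 goes. If [j < 4], it goes to 5, between 4 and
   6, and index 6 is where [n >= 7] is needed. If [j > 4], it goes to 3, between 2 and 4. If
   [j = 4], it goes to 3 with 2 and 5 still empty. *)
have [j3|j4|j4] := ltngtP j 4.
- have ne x : 3 < x -> (x == val j) = false by move=> lt; rewrite gtn_eqF // (leq_trans j3).
  exists (p5, true); split; first by rewrite legalE // E ne.
  by apply: (@dooms_11_fork _ _ p1 p4 p5 p6) => //; rewrite playE !E /= ?ne1 ?ne // BE !E.
- have ne x : x < 5 -> (x == val j) = false by move=> lt; rewrite ltn_eqF // (leq_trans lt).
  exists (p3, true); split; first by rewrite legalE // E ne.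
  by apply: (@dooms_11_fork _ _ p1 p2 p3 p4) => //; rewrite playE !E /= ?ne // BE !E.
have {}j4 : val j = 4 by [].
exists (p3, true); split; first by rewrite legalE // E j4.
by apply: (@dooms_1001 _ _ p1 p2 p3 p5) => //; rewrite playE !E //= j4 BE !E.
Qed.
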